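(* Every nontrivial upcycle has frame period at least $4$. Consequently, there do not exist nontrivial upcycles with parameters $(a,n,d)$ if $\gcd(a^{n-d},n)\le 3$.
   Context: Let $A$ be an alphabet with $a=|A|\ge 2$ letters and $\diamond\notin A$ a wildcard symbol (''diamond''). A partial word is a finite sequence over $A\cup\{\diamond\}$; a cyclic partial word $u=(u_1\cdots u_N)$ is cyclically ordered, with indices taken modulo $N$. A partial word $x$ covers a word $y$ of the same length if for each $i$ either $x_i=\diamond$ or $x_i=y_i$. For $n\ge 1$, an upcycle for $A^n$ is a cyclic partial word $u=(u_1\cdots u_N)$ such that for each word $y\in A^n$ there is exactly one position $i\in\{1,\dots,N\}$ such that the window $u_i\cdots u_{i+n-1}$ covers $y$. It is known that the diamonds of an upcycle are $n$-periodic ($u_i=\diamond$ implies $u_{i+n}=\diamond$), so all windows contain the same number $d$ of diamonds, called the diamondicity. An upcycle with parameters $(a,n,d)$ is an upcycle for $A^n$ with $|A|=a$ and diamondicity $d$. An upcycle is nontrivial if it contains at least one diamond and at least one letter. The frame of a (cyclic) partial word is obtained by replacing each letter by $\bullet$ and keeping each $\diamond$. The pane frame of a window with frame $f\in\{\bullet,\diamond\}^n$ is the shortest word $p$ such that $p^s=f$ for some positive integer $s$. The frame period of an upcycle for $A^n$ is the length of the pane frame of a window (independent of the window, since the window frames are cyclic shifts of each other); equivalently it is the minimum period of the frame of the upcycle. *)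

(* Defs.v *)
From mathcomp Require Import all_boot.

Set Implicit Arguments.
Unset Strict Implicit.
Unset Printing Implicit Defensive.

(* A partial word over A is a sequence over [option A], [None] being the
   diamond; a cyclic partial word is given by a representative [u]. *)

Section PartialWords.

Variable A : finType.

(* The window of length n starting at position i (positions from 0), with
   indices modulo N = size u; N may be smaller than n. The default value of
   [nth] is only reached when u is empty, and the empty word is never an
   upcycle when A is nonempty. *)
Definition window (n : nat) (u : seq (option A)) (i : nat) :
    n.-tuple (option A) :=
  [tuple nth None u ((i + j) %% size u) | j < n].

Definition covers (n : nat) (x : n.-tuple (option A)) (y : n.-tuple A) : bool :=
  [forall j : 'I_n, (tnth x j == None) || (tnth x j == Some (tnth y j))].

Definition upcycle (n : nat) (u : seq (option A)) : Prop :=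
  forall y : n.-tuple A, exists! i : 'I_(size u), covers (window n u i) y.

Definition diamondicity (n : nat) (u : seq (option A)) (d : nat) : Prop :=
  forall i : nat, count_mem None (window n u i) = d.

Definition upcycle_with_parameters (a n d : nat) (u : seq (option A)) : Prop :=
  [/\ #|A| = a, upcycle n u & diamondicity n u d].

Definition nontrivial (u : seq (option A)) : bool :=
  (None \in u) && has isSome u.

(* In a frame, [true] is the bullet (a letter) and [false] the diamond. *)
Definition frame (w : seq (option A)) : seq bool := [seq isSome c | c <- w].

End PartialWords.

Definition word_power (p : seq bool) (s : nat) : seq bool := flatten (nseq s p).

Definition pane_frame (f p : seq bool) : Prop :=
  (exists2 s, 0 < s & word_power p s = f) /\
  (forall q s, 0 < s -> word_power q s = f -> size p <= size q).

(* The pane frame itself depends on the window, but its length does not when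
   u is an upcycle. *)
Definition frame_period (A : finType) (n : nat) (u : seq (option A)) (m : nat)
    : Prop :=
  forall i : nat, exists2 p, pane_frame (frame (window n u i)) p & size p = m.

(* Main.v *)
Require Import Defs.
From mathcomp Require Import all_boot.
From mathcomp Require Import zify.

(** Let [m] be the minimum period of the frame of [u]. The frame has periods
    [n] and [N = size u], so [m] divides both, and [N = a ^ (n - d)] by double
    counting. If [m >= 2], take a word that is constant on each of its
    consecutive blocks of length [m]. Were the window covering it to begin
    with a diamond, the next window would cover it too, and symmetrically it
    cannot end with a diamond. For [m = 2] this leaves no diamond at all. For
    [m = 3] it forces the window frame to be [•◇•] repeated. Now let a window
    with frame [••◇] repeated read [x_0 y_0 ◇ x_1 y_1 ◇ ...]: the window
    covering the word [x_0 x_0 x_0 x_1 x_1 x_1 ...] has frame [•◇•] repeated,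
    so both windows cover [x_0 y_0 x_0 x_1 y_1 x_1 ...], which is absurd. *)

(** * Cyclic positions, covering and frames *)

Definition cyc {A : Type} (u : seq (option A)) (i : nat) : option A :=
  nth None u (i %% size u).

(** Words are functions on [nat], only values below [n] being relevant, so that shifts and blockwise
    definitions are plain arithmetic. *)
Definition covers_at {A : Type} (n : nat) (u : seq (option A)) (i : nat)
    (h : nat -> A) : Prop :=
  forall j, j < n -> cyc u (i + j) = None \/ cyc u (i + j) = Some (h j).

Definition is_letter {A : Type} (u : seq (option A)) (i : nat) : bool :=
  isSome (cyc u i).

Definition frame_has_period {A : Type} (u : seq (option A)) (m : nat) : Prop :=
  forall i, is_letter u (i + m) = is_letter u i.

Lemma size_flatten_nseq (T : Type) (p : seq T) s :
  size (flatten (nseq s p)) = s * size p.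
Proof. by elim: s => //= s IH; rewrite size_cat IH mulSn. Qed.

Lemma nth_flatten_nseq (T : Type) (x0 : T) (p : seq T) s j :
  j < s * size p -> nth x0 (flatten (nseq s p)) j = nth x0 p (j %% size p).
Proof.
elim: s j => [|s IH] j //=; rewrite mulSn nth_cat => ltj.
case: ltnP => lejp; first by rewrite modn_small.
rewrite IH; last by rewrite ltn_subLR.
by rewrite -{2}(subnK lejp) modnDr.
Qed.

Section Cyclic.

Variables (A : finType) (u : seq (option A)).

Lemma cyc_mod i j : i = j %[mod size u] -> cyc u i = cyc u j.
Proof. by rewrite /cyc => ->. Qed.

Lemma is_letter_mod i j : i = j %[mod size u] -> is_letter u i = is_letter u j.
Proof. by rewrite /is_letter => /cyc_mod ->. Qed.

Lemma cycD_mod i j k :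
  i = j %[mod size u] -> cyc u (i + k) = cyc u (j + k).
Proof. by move=> e; apply: cyc_mod; rewrite -modnDml e modnDml. Qed.

Lemma is_letterN i : ~~ is_letter u i -> cyc u i = None.
Proof. by rewrite /is_letter; case: (cyc u i). Qed.

Lemma tnth_window n i (j : 'I_n) : tnth (window n u i) j = cyc u (i + j).
Proof. by rewrite tnth_mktuple. Qed.

Lemma coversP n i (h : nat -> A) :
  reflect (covers_at n u i h)
          (covers (window n u i) [tuple h j | j < n]).
Proof.
apply: (iffP forallP) => [H j ltj | H j].
  have := H (Ordinal ltj); rewrite tnth_window tnth_mktuple /=.
  by case/orP=> /eqP ->; [left | right].
rewrite tnth_window tnth_mktuple.
by case: (H j (ltn_ord j)) => ->; rewrite eqxx ?orbT.
Qed.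

Lemma covers_at_mod n i j h :
  i = j %[mod size u] -> covers_at n u i h -> covers_at n u j h.
Proof. by move=> e H k ltk; rewrite -(cycD_mod i j k e); apply: H. Qed.

(** * Periods of the frame *)

Lemma frame_has_period_mul m k :
  frame_has_period u m -> frame_has_period u (k * m).
Proof.
move=> P; elim: k => [|k IH] i; first by rewrite addn0.
by rewrite mulSn addnA IH P.
Qed.

Lemma frame_has_period_size : frame_has_period u (size u).
Proof. by move=> i; apply: is_letter_mod; rewrite modnDr. Qed.

Lemma frame_has_period_modn m p :
  frame_has_period u m -> frame_has_period u p -> frame_has_period u (p %% m).
Proof.
move=> Pm Pp i; rewrite -(frame_has_period_mul m (p %/ m) Pm (i + p %% m)).
by rewrite -addnA [X in i + X]addnC -divn_eq Pp.
Qed.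

(** The remainder of a period modulo the least positive one is again a period, so by minimality it
    vanishes. *)
Lemma frame_min_period :
  0 < size u ->
  exists m, [/\ 0 < m, frame_has_period u m &
                 forall p, frame_has_period u p -> m %| p].
Proof.
move=> N0.
(* Testing one representative of each residue modulo [size u] suffices, and makes the predicate
   boolean for [ex_minnP]. *)
pose P m := (0 < m) && [forall i : 'I_(size u),
  is_letter u (i + m) == is_letter u i].
have PP m : reflect (0 < m /\ frame_has_period u m) (P m).
  apply: (iffP andP) => -[m0 H]; split=> //.
    move=> i; have /eqP/= H1 := forallP H (Ordinal (ltn_pmod i N0)).
    rewrite (is_letter_mod i (i %% size u)) ?modn_mod // -H1.
    by apply: is_letter_mod; rewrite modnDml.
  by apply/forallP => i; rewrite H.
have exP : exists m, P m.
  by exists (size u); apply/PP; split; last exact: frame_has_period_size.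
case: (ex_minnP exP) => m /PP[m0 Pm] min_m.
exists m; split=> // p Pp; rewrite /dvdn -leqn0 leqNgt; apply/negP => r0.
have Pr : P (p %% m) by apply/PP; split=> //; exact: frame_has_period_modn.
by have := min_m _ Pr; rewrite leqNgt ltn_pmod.
Qed.

Lemma diamond_in_pane m i j :
  0 < m -> frame_has_period u m -> ~~ is_letter u j ->
  exists2 r, r < m & ~~ is_letter u (i + r).
Proof.
move=> m0 Pm dj.
have Pkm k l : is_letter u (l + k * m) = is_letter u l.
  exact: frame_has_period_mul.
have le_im : i <= i * m by rewrite leq_pmulr.
(* This is [j - i] modulo [m]; adding [i * m] avoids truncated subtraction. *)
exists ((j + (i * m - i)) %% m); first by rewrite ltn_pmod.
rewrite -(Pkm ((j + (i * m - i)) %/ m)) -addnA [_ %% m + _]addnC -divn_eq.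
by rewrite (_ : i + _ = j + i * m) ?Pkm //; lia.
Qed.

Lemma size_frame_window n i : size (frame (window n u i)) = n.
Proof. by rewrite size_map size_tuple. Qed.

Lemma nth_frame_window n i j :
  j < n -> nth false (frame (window n u i)) j = is_letter u (i + j).
Proof.
move=> ltj; rewrite (nth_map None) ?size_tuple //.
by rewrite -[j]/(val (Ordinal ltj)) -tnth_nth tnth_window.
Qed.

(** Writing a window frame as a power of [q] makes [size q] a period inside the window; it divides
    [n], so the [n]-periodicity extends it to the whole frame, and [m] divides it. *)
Lemma frame_period_min_period n m :
  0 < n -> 0 < m -> frame_has_period u n -> frame_has_period u m ->
  (forall p, frame_has_period u p -> m %| p) ->
  frame_period n u m.
Proof.
move=> n0 m0 Pn Pm min_m i; have /dvdnP[k nE] := min_m n Pn.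
exists [seq is_letter u (i + j) | j <- iota 0 m]; last first.
  by rewrite size_map size_iota.
split.
  exists k; first by case: k nE n0 => // ->.
  apply: (@eq_from_nth _ false) => [|j].
    by rewrite size_flatten_nseq size_frame_window size_map size_iota.
  rewrite size_flatten_nseq size_map size_iota -nE => ltj.
  rewrite nth_flatten_nseq size_map size_iota -?nE // nth_frame_window //.
  have lt_r : j %% m < m by rewrite ltn_pmod.
  rewrite (nth_map 0) ?size_iota // nth_iota // add0n.
  rewrite {2}(divn_eq j m) [_ * m + _]addnC addnA.
  by rewrite (frame_has_period_mul m _ Pm).
move=> q s s0 qE; rewrite size_map size_iota.
have szq : s * size q = n.
  by rewrite -size_flatten_nseq -[RHS](size_frame_window n i) -qE.
have q0 : 0 < size q by case: (size q) szq n0 => //; rewrite muln0 => <-.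
have in_window j : j < n -> is_letter u (i + j) = nth false q (j %% size q).
  by move=> ltj; rewrite -(nth_frame_window n) // -qE nth_flatten_nseq ?szq.
have from_i j : is_letter u (i + j) = nth false q (j %% size q).
  rewrite {1}(divn_eq j n) [_ * n + _]addnC addnA (frame_has_period_mul n _ Pn).
  by rewrite in_window ?ltn_pmod // modn_dvdm // -szq dvdn_mull.
apply: dvdn_leq => //; apply: min_m => j.
(* Moving by [i * n] brings the position past [i], where [from_i] applies. *)
rewrite -[RHS](frame_has_period_mul n i Pn) -(frame_has_period_mul n i Pn).
have le_in : i <= i * n by rewrite leq_pmulr.
rewrite (_ : j + size q + i * n = i + (j + (i * n - i) + size q)); last by lia.
rewrite (_ : j + i * n = i + (j + (i * n - i))); last by lia.
by rewrite !from_i modnDr.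
Qed.

End Cyclic.

(** * Upcycles: periodic diamonds and exclusion of small periods *)

Section Upcycle.

Variables (A : finType) (n : nat) (u : seq (option A)).
Hypotheses (A2 : 2 <= #|A|) (n0 : 0 < n) (up : upcycle n u).

Lemma upcycle_ex (h : nat -> A) : exists i, covers_at n u i h.
Proof. by case: (up [tuple h j | j < n]) => i [/coversP ci _]; exists i. Qed.

Lemma upcycle_uniq (h : nat -> A) i j :
  covers_at n u i h -> covers_at n u j h -> i = j %[mod size u].
Proof.
case: (up [tuple h j | j < n]) => k [_ uniq_k].
have N0 : 0 < size u by apply: leq_ltn_trans (ltn_ord k).
have eq_k l : covers_at n u l h -> l %% size u = k.
  move=> cl; have -> // : k = Ordinal (ltn_pmod l N0).
  by apply: uniq_k; apply/coversP; apply: covers_at_mod cl; rewrite /= modn_mod.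
by move=> /eq_k -> /eq_k ->.
Qed.

Lemma exists_other (c : A) : exists c', c' != c.
Proof.
have /card_gt1P[x [y [_ _ xy]]] := A2.
by have [<-|xc] := eqVneq x c; [exists y; rewrite eq_sym | exists x].
Qed.

(* If [u] has a diamond at [i] and a letter [c] at [i + n], take a word fitting
   the window at [i.+1] except that its last letter is not [c]. It is covered
   at some [k.+1] instead; moved right by one with a letter put in front, it is
   covered both at [k] and, thanks to the diamond, at [i]: so [k = i]. *)
Lemma diamond_shift i : ~~ is_letter u i -> ~~ is_letter u (i + n).
Proof.
move=> /is_letterN ui; rewrite /is_letter.
case uin: (cyc u (i + n)) => [c|//].
have [c' c'c] := exists_other c.
pose h j := if j == n.-1 then c' else odflt c (cyc u (i + j.+1)).
have [k0 ck0] := upcycle_ex h.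
have N0 : 0 < size u.
  by rewrite lt0n; apply/eqP => u0; move: uin; rewrite /cyc nth_default ?u0.
pose k := k0 + (size u).-1.
have ck : covers_at n u k.+1 h.
  by apply: covers_at_mod ck0; rewrite /k -addnS prednK // modnDr.
pose h' j := if j is j'.+1 then h j' else odflt c (cyc u k).
have ckh' : covers_at n u k h'.
  move=> [|j] ltj /=; first by rewrite addn0; case: (cyc u k); [right|left].
  by rewrite -addSnnS; apply: ck; apply: ltnW.
have cih' : covers_at n u i h'.
  move=> [|j] ltj /=; first by left; rewrite addn0.
  rewrite /h ifN; last by lia.
  by case: (cyc u (i + j.+1)); [right|left].
have ki := upcycle_uniq _ _ _ ckh' cih'.
have := ck n.-1; rewrite prednK // addSnnS prednK // => /(_ (leqnn _)).
rewrite (cycD_mod _ _ _ _ _ ki) uin /h eqxx => -[|[ec]] //.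
by rewrite ec eqxx in c'c.
Qed.

Lemma upcycle_frame_has_period : frame_has_period u n.
Proof.
move=> i; apply/idP/idP; apply: contraTT; first exact: diamond_shift.
have shift k : ~~ is_letter u (i + n) -> ~~ is_letter u (i + n + k * n).
  move=> H; elim: k => [|k IH]; first by rewrite addn0.
  by rewrite mulSn [n + _]addnC addnA diamond_shift.
(* Going round the cycle: [size u] steps of length [n] lead from [i] back to [i]. *)
move=> /(shift (size u).-1); rewrite -addnA -mulSn.
have [u0|N0] := posnP (size u).
  by rewrite /is_letter /cyc !nth_default ?u0.
by rewrite prednK // (is_letter_mod _ _ _ i) // mulnC addnC modnMDl.
Qed.

(** A diamond at the first position recurs at every block start. Sliding the window by one thus
    changes the letter demanded only where the window has a diamond, so two adjacent positions cover
    [h]; they are distinct as [1 < size u]. The last position is symmetric. *)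
Lemma pane_constant_letters m (h : nat -> A) i :
  1 < size u -> 0 < m -> m %| n -> frame_has_period u m ->
  (forall j, j.+1 %% m != 0 -> h j.+1 = h j) -> covers_at n u i h ->
  is_letter u i /\ is_letter u (i + m.-1).
Proof.
move=> N1 m0 mn Pm hm ci.
have Pkm k j : is_letter u (j + k * m) = is_letter u j.
  exact: frame_has_period_mul.
have absurd j : ~ (covers_at n u j h /\ covers_at n u j.+1 h).
  case=> cj cj1; have /eqP := upcycle_uniq _ _ _ cj cj1.
  rewrite -[j in X in X == _]addn0 -addn1 eqn_modDl mod0n modn_small //.
split; apply/negPn/negP => dia.
  apply: (absurd i); split=> // j ltj; rewrite addSnnS.
  have [j0|jn0] := eqVneq (j.+1 %% m) 0.
    left; apply: is_letterN.
    by rewrite (divn_eq j.+1 m) j0 addn0 Pkm.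
  rewrite -(hm j jn0); apply: ci.
  (* [j.+1] stays inside the window: [n] itself is a block boundary. *)
  rewrite ltn_neqAle ltj andbT; apply: contraNneq jn0 => ->.
  by rewrite -/(dvdn m n).
(* The cyclic predecessor of [i]. *)
pose k := i + (size u).-1.
have ek : k.+1 = i %[mod size u] by rewrite /k -addnS prednK ?modnDr // ltnW.
have dk : ~~ is_letter u k.
  rewrite -[k](addn0) -(Pm (k + 0)) addn0 -(prednK m0) -addSnnS.
  by rewrite (is_letter_mod _ _ _ (i + m.-1)) // -modnDml ek modnDml.
have ck1 : covers_at n u k.+1 h by apply: covers_at_mod ci.
apply: (absurd k); split=> // -[|j] ltj.
  by left; apply: is_letterN; rewrite addn0.
have [j0|jn0] := eqVneq (j.+1 %% m) 0.
  left; apply: is_letterN.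
  by rewrite (divn_eq j.+1 m) j0 addn0 Pkm.
by rewrite (hm j jn0) -addSnnS; apply: ck1; apply: ltnW.
Qed.

Lemma nontrivialP : nontrivial u ->
  [/\ exists i, is_letter u i, exists i, ~~ is_letter u i & 1 < size u].
Proof.
case/andP=> /(nthP None)[i lti ui] /(has_nthP None)[j ltj uj].
have li : is_letter u i = false by rewrite /is_letter /cyc modn_small // ui.
have lj : is_letter u j by rewrite /is_letter /cyc modn_small.
split; [by exists j | by exists i; rewrite li |].
rewrite ltnNge; apply/negP => N1.
have := leq_trans lti N1; have := leq_trans ltj N1.
by rewrite !ltnS !leqn0 => /eqP j0 /eqP i0; rewrite i0 -j0 lj in li.
Qed.

Lemma upcycle_period_gt3 m :
  nontrivial u -> 0 < m -> m %| n -> frame_has_period u m -> 3 < m.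
Proof.
move=> /nontrivialP[[il lil] [id did] N1] m0 mn Pm.
have c : A by move: lil; rewrite /is_letter; case: (cyc u il).
have [i ci] := upcycle_ex (fun=> c).
have [li lim] : is_letter u i /\ is_letter u (i + m.-1).
  exact: pane_constant_letters ci.
have [r ltr dr] := diamond_in_pane _ _ m i id m0 Pm did.
have r0 : r != 0 by apply: contraNneq dr => ->; rewrite addn0.
have rm : r != m.-1 by apply: contraNneq dr => ->.
rewrite ltnNge; apply/negP => m_le3.
(* The diamond at offset [r] is neither first nor last in its pane. *)
have m3 : m = 3 by lia.
have r1 : r = 1 by lia.
subst m r; rewrite /= in lim.
(* From [i] the panes read [•◇•], so from [i + 2] they read [••◇]. *)
pose i0 := i + 2.
have l0 : is_letter u i0 by [].
have l1 : is_letter u i0.+1 by rewrite /i0 -addnS Pm.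
have d2 : ~~ is_letter u (i0 + 2).
  by rewrite /i0 -addnA -[2 + 2]/(1 + 3) addnA Pm.
(* Each block repeats the first letter of its pane at [i0]; as that position holds a letter, the
   default [c] is never taken. *)
pose x j := odflt c (cyc u (i0 + j %/ 3 * 3)).
have [k ck] := upcycle_ex x.
have x3 j : j.+1 %% 3 != 0 -> x j.+1 = x j.
  by move=> jn0; rewrite /x (_ : j.+1 %/ 3 = j %/ 3) //; lia.
have [lk lk2] : is_letter u k /\ is_letter u (k + 2).
  exact: (pane_constant_letters 3 x).
have dk1 : ~~ is_letter u k.+1.
  have [[|[|[|q]]] // _] := diamond_in_pane _ _ 3 k id m0 Pm did.
  - by rewrite addn0 lk.
  - by rewrite addn1.
  - by rewrite lk2.
(* The middle letters, hidden by diamonds at [k], are taken from the window at [i0], whose own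
   diamonds hide the third letters. *)
pose xyx j := if j %% 3 == 1 then odflt c (cyc u (i0 + j)) else x j.
have split3 p j : is_letter u (p + j) = is_letter u (p + j %% 3).
  by rewrite {1}(divn_eq j 3) [_ + j %% 3]addnC addnA frame_has_period_mul.
have ckxyx : covers_at n u k xyx.
  move=> j ltj; rewrite /xyx; case: eqP => [j1|_]; last exact: ck.
  by left; apply: is_letterN; rewrite split3 j1 addn1.
have c0xyx : covers_at n u i0 xyx.
  move=> j ltj; rewrite /xyx; case: eqP => [_|/eqP j1].
    by case: (cyc u (i0 + j)); [right|left].
  have [j2|jn2] := eqVneq (j %% 3) 2.
    by left; apply: is_letterN; rewrite split3 j2.
  have j0 : j = j %/ 3 * 3 by lia.
  by rewrite /x -j0; case: (cyc u (i0 + j)); [right|left].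
have e := upcycle_uniq _ _ _ ckxyx c0xyx.
move: dk1; rewrite (is_letter_mod _ _ _ i0.+1) ?l1 //.
by rewrite -addn1 -modnDml e modnDml addn1.
Qed.

End Upcycle.

(** * Length of an upcycle and the conclusion *)

Lemma card_covered (A : finType) n (w : n.-tuple (option A)) :
  #|[pred y : n.-tuple A | covers w y]| = #|A| ^ count_mem None w.
Proof.
pose F (j : 'I_n) := [pred c : A | (tnth w j == None) || (tnth w j == Some c)].
pose ft (f : {ffun 'I_n -> A}) := [tuple f j | j < n].
have ft_inj : injective ft.
  move=> f g /(congr1 (fun t => tnth t)) e; apply/ffunP => j.
  by have := congr1 (@^~ j) e; rewrite /= !tnth_mktuple.
rewrite (_ : #|_| = #|family F|); last first.
  rewrite -(card_image ft_inj); apply: eq_card => y; rewrite !inE.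
  apply/idP/imageP => [cy | [f /familyP Ff ->]].
    exists [ffun j => tnth y j]; last first.
      by apply: eq_from_tnth => j; rewrite tnth_mktuple ffunE.
    by apply/familyP => j; rewrite ffunE; apply: (forallP cy).
  by apply/forallP => j; rewrite tnth_mktuple; apply: Ff.
rewrite card_family foldrE big_image /=.
rewrite -sum1_count big_tuple [in RHS]big_mkcond expn_sum.
(* A diamond leaves all of [A] free, a letter leaves one choice. *)
apply: eq_bigr => j _; case: (tnth w j) => [b|] /=; last first.
  by rewrite expn1; apply: eq_card.
rewrite expn0 -(card1 b); apply: eq_card => c.
by rewrite !inE; apply/eqP/eqP => [[->]|->].
Qed.

(** Count pairs of a position and a word covered there: each position covers [#|A| ^ d] words, and
    each of the [#|A| ^ n] words has one position. *)
Lemma size_upcycle (A : finType) n d (u : seq (option A)) :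
  0 < #|A| -> upcycle n u -> diamondicity n u d -> size u = #|A| ^ (n - d).
Proof.
move=> A0 up dn.
have le_dn : d <= n.
  by rewrite -(dn 0) -[leqRHS](size_tuple (window n u 0)) count_size.
have -> : size u = \sum_(i < size u) 1 by rewrite sum1_card card_ord.
apply/eqP; rewrite -(eqn_pmul2r (_ : 0 < #|A| ^ d)) ?expn_gt0 ?A0 //.
rewrite -expnD subnK // big_distrl /= -(card_tuple n A).
rewrite -[in X in _ == X]sum1_card.
have card_i (i : 'I_(size u)) :
    1 * #|A| ^ d = \sum_(y : n.-tuple A) covers (window n u i) y.
  rewrite mul1n -(dn i) -card_covered -sum1_card big_mkcond /=.
  by apply: eq_bigr => y _; rewrite inE; case: covers.
rewrite (eq_bigr _ (fun i _ => card_i i)) exchange_big /=.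
apply/eqP; apply: eq_bigr => y _; have [i [ci uniq_i]] := up y.
rewrite (bigD1 i) //= ci big1 // => j; apply: contraNeq.
by rewrite eqb0 negbK => /uniq_i ->.
Qed.

(** Serves both claims: the divisibility, due to [n] and [size u] both being frame periods, turns
    the lower bound on [m] into one on the gcd. *)
Lemma upcycle_frame_period (A : finType) n (u : seq (option A)) :
  2 <= #|A| -> 1 <= n -> upcycle n u -> nontrivial u ->
  exists m, [/\ frame_period n u m, 4 <= m & m %| gcdn (size u) n].
Proof.
move=> A2 n0 up nt.
have Pn : frame_has_period u n by apply: upcycle_frame_has_period.
have N0 : 0 < size u by case/nontrivialP: nt => _ _ /ltnW.
have [m [m0 Pm dvd_m]] := frame_min_period _ u N0.
have mn := dvd_m n Pn.
exists m; split.
- apply: frame_period_min_period => //.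
- exact: (upcycle_period_gt3 A n u).
- by rewrite dvdn_gcd mn (dvd_m _ (frame_has_period_size _ u)).
Qed.

Theorem corollary8p13 :
  (forall (A : finType) (n : nat) (u : seq (option A)),
      2 <= #|A| -> 1 <= n -> upcycle n u -> nontrivial u ->
      exists2 m : nat, frame_period n u m & 4 <= m) /\
  (forall a n d : nat,
      2 <= a -> 1 <= n -> gcdn (a ^ (n - d)) n <= 3 ->
      ~ (exists (A : finType) (u : seq (option A)),
            upcycle_with_parameters a n d u /\ nontrivial u)).
Proof.
split=> [A n u A2 n0 up nt | a n d a2 n0 gcd3 [A [u [[cA up dn] nt]]]].
  by have [m [fm m4 _]] := upcycle_frame_period A n u A2 n0 up nt; exists m.
rewrite -cA in a2 gcd3.
have [m [_ m4 m_dvd]] := upcycle_frame_period A n u a2 n0 up nt.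
rewrite (size_upcycle A n d) ?(ltnW a2) // in m_dvd.
have gcd0 : 0 < gcdn (#|A| ^ (n - d)) n by rewrite gcdn_gt0 n0 orbT.
by have := leq_trans (leq_trans m4 (dvdn_leq gcd0 m_dvd)) gcd3.
Qed.
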